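(* Let $L,S\ge1$ be integers, let $\beta$ be the positive solution of $L\beta+S\beta^2=1$, and let $f_{L,S}:[0,1)\to[0,1)$ be the interval exchange transformation of $L+S$ intervals $I_1,\ldots,I_{L+S}$ defined in the context. Let $r\in\mathbb{Z}$ be arbitrary, choose $q_0\in\mathbb{Z}$ such that $\{-r\beta-q_0\beta^2\}\in I_1$ but $\{-r\beta-(q_0+1)\beta^2\}\notin I_1$, and set $x_0=\{-r\beta-q_0\beta^2\}$. If $L\ge S$, then the orbit $\{f_{L,S}^n(x_0) : n\in\mathbb{Z}\}$ equals, as a set, $$\mathcal{J}_{L,S}=\bigl\{\{m\beta+n\beta^2\}\ :\ m,n\in\mathbb{Z}\bigr\}.$$
   Context: For a real number $z$, $\{z\}=z-\lfloor z\rfloor$ denotes its fractional part. The map $f_{L,S}$: partition $[0,1)$ from left to right into consecutive half-open intervals $I_1,\ldots,I_{L+S}$ (left endpoints included), where $I_i$ has length $\beta$ for $1\le i\le L$ and length $\beta^2$ for $L+1\le i\le L+S$. In particular $I_1=[0,\beta)$. The bijective map $f_{L,S}:[0,1)\to[0,1)$ rearranges these intervals by translations so that their left-to-right order after applying $f_{L,S}$ is $I_2,\ldots,I_L,\ I_{L+S},\ I_1,\ I_{L+1},\ldots,I_{L+S-1}$. Explicitly, $f_{L,S}(x)=x+w_i$ for $x\in I_i$, where $$w_1=(L-1)\beta+\beta^2,\qquad w_i=-\beta\ \ (2\le i\le L),\qquad w_i=\beta^2\ \ (L+1\le i\le L+S-1),\qquad w_{L+S}=-(S-1)\beta^2-\beta.$$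 For $n<0$, $f_{L,S}^n$ denotes the corresponding power of the inverse map. *)

(* Defs.v *)
From mathcomp Require Import all_boot all_order all_algebra.
From mathcomp Require Import all_classical all_reals.

Set Implicit Arguments.
Unset Strict Implicit.
Unset Printing Implicit Defensive.

Import Order.TTheory GRing.Theory Num.Theory.

Local Open Scope classical_set_scope.
Local Open Scope ring_scope.

Definition fpart {R : realType} (z : R) : R := z - (Num.floor z)%:~R.

(* Intervals are numbered from 1 to L + S. *)

Definition iet_len {R : realType} (L : nat) (beta : R) (i : nat) : R :=
  if (i <= L)%N then beta else beta ^+ 2.

Definition iet_left {R : realType} (L : nat) (beta : R) (i : nat) : R :=
  \sum_(1 <= j < i) iet_len L beta j.

Definition iet_itv {R : realType} (L : nat) (beta : R) (i : nat) : interval R :=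
  `[iet_left L beta i, iet_left L beta i + iet_len L beta i[.

Definition iet_shift {R : realType} (L S : nat) (beta : R) (i : nat) : R :=
  if i == 1%N then (L%:R - 1) * beta + beta ^+ 2
  else if (i <= L)%N then - beta
  else if (i < L + S)%N then beta ^+ 2
  else - ((S%:R - 1) * beta ^+ 2) - beta.

(* The intervals are disjoint, so the sum has exactly one term when x is in
   [0, 1[; it is empty, and the map is the identity, elsewhere. *)
Definition iet {R : realType} (L S : nat) (beta x : R) : R :=
  x + \sum_(1 <= i < (L + S).+1 | x \in iet_itv L beta i)
        iet_shift L S beta i.

(* When L * beta + S * beta ^+ 2 = 1 and beta > 0, iet L S beta is a bijection
   of [0, 1[ onto itself, so that the partial inverse below is its inverse. *)
Definition iet_inv {R : realType} (L S : nat) (beta : R) : R -> R :=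
  'pinv_(fun=> 0) (`[0, 1[ : set R) (iet L S beta).

Definition iet_iter {R : realType} (L S : nat) (beta : R) (n : int) (x : R) : R :=
  match n with
  | Posz k => iter k (iet L S beta) x
  | Negz k => iter k.+1 (iet_inv L S beta) x
  end.

Definition iet_orbit {R : realType} (L S : nat) (beta x : R) : set R :=
  [set iet_iter L S beta n x | n in [set: int]].

Definition Jset {R : realType} (beta : R) : set R :=
  [set y | exists m n : int, y = fpart (m%:~R * beta + n%:~R * beta ^+ 2)].

(* Main.v *)
Require Import Defs.
From mathcomp Require Import all_boot all_order all_algebra.
From mathcomp Require Import all_classical all_reals.
From mathcomp Require Import ring lra zify.

Import Order.TTheory GRing.Theory Num.Theory.

Local Open Scope classical_set_scope.
Local Open Scope ring_scope.

(** Put M = Z beta + Z beta ^ 2.  Since 1 = L beta + S beta ^ 2 lies in M,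
    [Jset beta] is M intersected with [0, 1[, and the exchange f moves every
    point by an element of M; as f is a bijection of [0, 1[, the orbit of a
    point of M stays in M ([iet_orbit_sub_Jset]).

    For the converse, induce f on the first interval [0, beta[.  A point u of
    [0, beta - beta ^ 2[ is sent to the top long interval and then descends by
    steps of - beta, so it comes back as u + beta ^ 2.  A point u of
    [beta - beta ^ 2, beta[ is sent to the bottom short interval, climbs by
    steps of beta ^ 2, is moved from the last interval to the top long
    interval, descends, and comes back as u + beta ^ 2 - beta.  So the first
    return map to [0, beta[ is the rotation by beta ^ 2 on the circle of length
    beta ([joined_rotation_low], [joined_rotation_high]).  Modulo beta the points of
    M are the multiples of beta ^ 2, so M intersected with [0, beta[ is the
    single orbit of 0 under that rotation ([joined_base0]).  Each point of
    [0, 1[ is moreover on the f-orbit of a point of [0, beta[ ([joined_base]).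

    To avoid counting iterations, forward orbits are compared through the
    relation [joined f x y] (the forward orbits of x and y meet), which is an
    equivalence.  Two joined points of [0, 1[ lie on the same two-sided orbit
    because f is injective there ([joined_iet_orbit]). *)

(** * Points whose forward orbits meet *)

Section Joined.
Variables (T : Type) (f : T -> T).

Definition joined (x y : T) := exists p q : nat, iter p f x = iter q f y.

Lemma joined_refl x : joined x x.
Proof. by exists 0%N, 0%N. Qed.

Lemma joined_sym x y : joined x y -> joined y x.
Proof. by move=> [p [q e]]; exists q, p. Qed.

Lemma joined_trans y x z : joined x y -> joined y z -> joined x z.
Proof.
move=> [p [q e]] [p' [q' e']]; exists (p' + p)%N, (q + q')%N.
by rewrite iterD e -iterD addnC iterD e' -iterD.
Qed.

Lemma joined_step x : joined x (f x).
Proof. by exists 1%N, 0%N. Qed.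

End Joined.

Arguments joined {T} f x y.
Arguments joined_refl {T f} x.
Arguments joined_sym {T f x y} _.
Arguments joined_trans {T f y x z} _ _.
Arguments joined_step {T} f x.

(** * The module spanned by beta and its square, and division by a length *)

Section Lattice.
Variables (R : realType) (beta : R).

Definition lattice : set R :=
  [set x | exists m n : int, x = m%:~R * beta + n%:~R * beta ^+ 2].

Lemma latticeI m n : lattice (m%:~R * beta + n%:~R * beta ^+ 2).
Proof. by exists m, n. Qed.

Lemma latticeB x y : lattice x -> lattice y -> lattice (x - y).
Proof.
move=> [m [n ->]] [m' [n' ->]]; exists (m - m'), (n - n').
by rewrite !intrB; ring.
Qed.

Lemma latticeMz (k : int) x : lattice x -> lattice (k%:~R * x).
Proof. by move=> [m [n ->]]; exists (k * m), (k * n); rewrite !intrM; ring. Qed.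

Lemma lattice0 : lattice 0.
Proof. by exists 0, 0; rewrite !mul0r addr0. Qed.

Lemma latticeN x : lattice x -> lattice (- x).
Proof. by rewrite -[- x]sub0r; apply: latticeB; exact: lattice0. Qed.

Lemma latticeD x y : lattice x -> lattice y -> lattice (x + y).
Proof. by move=> lx ly; rewrite -[y]opprK; apply/latticeB/latticeN. Qed.

Lemma lattice_beta : lattice beta.
Proof. by exists 1, 0; rewrite mul1r mul0r addr0. Qed.

Lemma lattice_beta2 : lattice (beta ^+ 2).
Proof. by exists 0, 1; rewrite mul1r mul0r add0r. Qed.

End Lattice.

Arguments lattice {R} beta _.
Arguments lattice_beta {R beta}.
Arguments lattice_beta2 {R beta}.
Arguments latticeMz {R beta} k {x} _.

Lemma euclid_nat (R : realDomainType) (d x : R) n : 0 <= x < n%:R * d ->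
  exists2 k : nat, (k < n)%N & 0 <= x - k%:R * d < d.
Proof.
elim: n => [|n IH] /andP[x0]; first by rewrite mul0r ltNge x0.
rewrite -natr1 mulrDl mul1r => xn; have [xlt|nx] := ltP x (n%:R * d).
  by have [|k kn ?] := IH; [rewrite x0|exists k => //; exact: ltnW].
by exists n => //; lra.
Qed.

(** * The exchange as a piecewise translation *)

Section Exchange.
Variables (R : realType) (L S : nat) (beta : R).
Hypotheses (L_gt0 : (0 < L)%N) (S_gt0 : (0 < S)%N) (beta_gt0 : 0 < beta).
Hypothesis total_length : L%:R * beta + S%:R * beta ^+ 2 = 1.

Local Notation f := (iet L S beta).

Let beta2_gt0 : 0 < beta ^+ 2. Proof. exact: exprn_gt0. Qed.

Let beta_le_long : beta <= L%:R * beta.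
Proof. by rewrite ler_peMl ?ler1n // ltW. Qed.

Let long_le : L%:R * beta + beta ^+ 2 <= 1.
Proof. by rewrite -[leRHS]total_length lerD2l ler_peMl ?ler1n // ltW. Qed.

Let beta2_lt : beta ^+ 2 < beta.
Proof. rewrite expr2 gtr_pMr //; move: beta_le_long long_le beta2_gt0; lra. Qed.

Lemma iet_leftS i :
  iet_left L beta i.+2 = iet_left L beta i.+1 + iet_len L beta i.+1.
Proof. by rewrite /iet_left big_nat_recr. Qed.

Lemma iet_left1 : iet_left L beta 1 = 0.
Proof. by rewrite /iet_left big_geq. Qed.

Lemma iet_len_gt0 i : 0 < iet_len L beta i.
Proof. by rewrite /iet_len; case: ifP. Qed.

Lemma iet_left_le {i j} : (i <= j)%N ->
  iet_left L beta i.+1 <= iet_left L beta j.+1.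
Proof.
move=> /subnK <-; elim: (j - i)%N => [|k IH]; rewrite ?add0n ?lexx//.
by rewrite addSn iet_leftS (le_trans IH)// lerDl ltW// iet_len_gt0.
Qed.

Lemma iet_left_long i : (i <= L)%N -> iet_left L beta i.+1 = i%:R * beta.
Proof.
elim: i => [|i IH] iL; first by rewrite iet_left1 mul0r.
by rewrite iet_leftS IH 1?ltnW// /iet_len iL -natr1 mulrDl mul1r.
Qed.

Lemma iet_left_short k :
  iet_left L beta (L + k).+1 = L%:R * beta + k%:R * beta ^+ 2.
Proof.
elim: k => [|k IH]; first by rewrite addn0 iet_left_long// mul0r addr0.
rewrite addnS iet_leftS IH /iet_len ifN -?natr1; first by ring.
by rewrite -ltnNge ltnS leq_addr.
Qed.

Lemma iet_itv_cover x n : 0 <= x < iet_left L beta n.+1 ->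
  exists2 i, (i < n)%N & x \in iet_itv L beta i.+1.
Proof.
elim: n => [|n IH] /andP[x0]; first by rewrite iet_left1 ltNge x0.
rewrite iet_leftS => xn; have [xlt|nx] := ltP x (iet_left L beta n.+1).
  by have [|i ? ?] := IH; [rewrite x0|exists i => //; exact: ltnW].
by exists n => //; rewrite in_itv /= nx.
Qed.

Lemma iet_itv_disjoint x i j :
  x \in iet_itv L beta i.+1 -> x \in iet_itv L beta j.+1 -> i = j.
Proof.
rewrite !in_itv/= -!iet_leftS => /andP[ix xi] /andP[jx xj].
by have [ij|ij|//] := ltngtP i j;
  have := iet_left_le ij;
  rewrite leNgt ?(le_lt_trans ix xj) ?(le_lt_trans jx xi).
Qed.

Lemma iet_on_itv x i : (i < L + S)%N -> x \in iet_itv L beta i.+1 ->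
  f x = x + iet_shift L S beta i.+1.
Proof.
move=> iLS xi; rewrite /iet; congr (_ + _).
rewrite -big_filter (_ : [seq _ <- _ | _] = [:: i.+1]) ?big_seq1//.
rewrite (_ : [seq _ <- _ | _] = [seq j <- index_iota 1 (L + S).+1 | j == i.+1]).
  by rewrite filter_pred1_uniq ?iota_uniq ?mem_index_iota.
apply: eq_in_filter => j; rewrite mem_index_iota; case: j => // j _.
apply/idP/eqP => [xj|[->]//]; congr _.+1; exact: iet_itv_disjoint xj xi.
Qed.

(** The intervals with a common translation are merged, and the translations
    are written with L beta as only integer multiple: S beta ^ 2 is eliminated
    through the total length, so that every later comparison is linear in
    beta, beta ^ 2 and L beta. *)
Variant iet_spec x : R -> Prop :=
| IetFirst of 0 <= x < beta : iet_spec x (x + (L%:R * beta - beta + beta ^+ 2))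
| IetLong of beta <= x < L%:R * beta : iet_spec x (x - beta)
| IetShort of L%:R * beta <= x < 1 - beta ^+ 2 : iet_spec x (x + beta ^+ 2)
| IetLast of 1 - beta ^+ 2 <= x < 1 :
    iet_spec x (x + (L%:R * beta - 1 + beta ^+ 2 - beta)).

Lemma ietP x : 0 <= x < 1 -> iet_spec x (f x).
Proof.
move=> x01; have [|i iLS xi] := iet_itv_cover x (L + S).
  by rewrite iet_left_short total_length.
rewrite (iet_on_itv _ _ iLS xi).
move: xi; rewrite in_itv/= -iet_leftS; case: i iLS => [|i] iLS.
  rewrite iet_left1 iet_left_long// mul1r => xi.
  rewrite /iet_shift eqxx.
  rewrite (_ : (_ - 1) * _ + _ = L%:R * beta - beta + beta ^+ 2); last by ring.
  exact: IetFirst.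
have [iL|Li] := ltnP i.+1 L.
  rewrite !iet_left_long ?(ltnW iL)// => /andP[ix xi].
  rewrite /iet_shift/= iL; apply: IetLong; apply/andP; split.
    by apply: le_trans ix; rewrite ler_peMl ?ler1n// ltW.
  by apply: lt_le_trans xi _; rewrite ler_wpM2r ?ler_nat// ltW.
rewrite /iet_shift/= ltnNge Li/=.
move: iLS; rewrite -(subnKC Li); set k := (i.+1 - L)%N.
rewrite ltn_add2l iet_left_short -addnS iet_left_short ltn_add2l.
move=> kS /andP[kx xk].
have k1 : k.+1%:R * beta ^+ 2 = k%:R * beta ^+ 2 + beta ^+ 2.
  by rewrite -natr1 mulrDl mul1r.
case: ltnP => [k1S|Sk].
  apply: IetShort; apply/andP; split.
    by apply: le_trans kx; rewrite lerDl mulr_ge0// ltW.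
  have : k.+2%:R * beta ^+ 2 <= S%:R * beta ^+ 2.
    by rewrite ler_wpM2r ?ler_nat// ltW.
  rewrite -natr1 mulrDl mul1r; move: xk total_length; lra.
have {Sk}kS : k.+1 = S by apply/eqP; rewrite eqn_leq kS Sk.
rewrite (_ : - _ - _ = L%:R * beta - 1 + beta ^+ 2 - beta).
  by apply: IetLast; move: kx xk k1 total_length; rewrite kS; lra.
by rewrite mulrBl mul1r; move: total_length; lra.
Qed.

Ltac iet_lra :=
  move: total_length beta_gt0 beta2_gt0 beta_le_long long_le beta2_lt; lra.

Lemma iet_itv01 x : 0 <= x < 1 -> 0 <= f x < 1.
Proof. by case/ietP=> xi; iet_lra. Qed.

Lemma iet_inj x y : 0 <= x < 1 -> 0 <= y < 1 -> f x = f y -> x = y.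
Proof. by case/ietP=> xi; case/ietP=> yi e; iet_lra. Qed.

(** The inverse translations act on consecutive intervals, in the order of the
    images: I_2, ..., I_L, then I_(L+S), then I_1, then the other short ones. *)
Lemma iet_surj y : 0 <= y < 1 -> exists2 x, 0 <= x < 1 & f x = y.
Proof.
move=> y01.
pose x :=
  if y < L%:R * beta - beta then y + beta else
  if y < L%:R * beta - beta + beta ^+ 2
    then y - (L%:R * beta - 1 + beta ^+ 2 - beta) else
  if y < L%:R * beta + beta ^+ 2 then y - (L%:R * beta - beta + beta ^+ 2)
  else y - beta ^+ 2.
have x01 : 0 <= x < 1.
  by rewrite /x; case: ltP => ?; [|case: ltP => ?; [|case: ltP => ?]]; iet_lra.
exists x => //; case/ietP: (x01) => {x01}; rewrite /x;
  by case: ltP => ?; [|case: ltP => ?; [|case: ltP => ?]]; iet_lra.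
Qed.

(** * The orbit stays in the lattice *)

Lemma lattice1 : lattice beta 1.
Proof. by exists L, S; exact: esym. Qed.

Lemma lattice_iet x : 0 <= x < 1 -> lattice beta (f x - x).
Proof.
have lb := @lattice_beta _ beta; have lb2 := @lattice_beta2 _ beta.
have lL : lattice beta (L%:R * beta) := latticeMz L lb.
have l1 := lattice1.
by case/ietP => _; rewrite addrAC subrr add0r;
  do ?[apply: latticeD|apply: latticeN].
Qed.

(** Taking the fractional part subtracts an integer, which lies in the lattice
    because 1 does. *)
Lemma JsetE y : Jset beta y <-> 0 <= y < 1 /\ lattice beta y.
Proof.
split=> [[m [n ->]]|[y01 [m [n e]]]].
  have := floor_itv (m%:~R * beta + n%:~R * beta ^+ 2).
  rewrite /fpart intrD mulr1z => fl; split; first by lra.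
  apply: latticeB; first exact: latticeI.
  by rewrite -[_%:~R]mulr1; exact/latticeMz/lattice1.
by exists m, n; rewrite -e /fpart (@floor_def _ y 0) ?subr0.
Qed.

Lemma iet_inv_spec y : 0 <= y < 1 ->
  0 <= iet_inv L S beta y < 1 /\ f (iet_inv L S beta y) = y.
Proof.
move=> /iet_surj[x x01 <-]; rewrite /iet_inv pinvKV ?inE/= ?in_itv//.
by move=> u v; rewrite !inE/= !in_itv/=; exact: iet_inj.
Qed.

Lemma iter_iet_itv01 n x : 0 <= x < 1 -> 0 <= iter n f x < 1.
Proof. by move=> x01; elim: n => //= n; exact: iet_itv01. Qed.

Lemma Jset_iet x : Jset beta x -> Jset beta (f x).
Proof.
move=> /JsetE[x01 lx]; apply/JsetE; split; first exact: iet_itv01.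
by rewrite -[f x](subrK x); apply: latticeD => //; exact: lattice_iet.
Qed.

Lemma Jset_iet_inv x : Jset beta x -> Jset beta (iet_inv L S beta x).
Proof.
move=> /JsetE[/iet_inv_spec[y01 fy] lx]; apply/JsetE; split=> //.
set y := iet_inv L S beta x in y01 fy *.
by rewrite -[y](subKr x) -{2}fy; apply: latticeB => //; exact: lattice_iet.
Qed.

Lemma iet_orbit_sub_Jset x : Jset beta x -> iet_orbit L S beta x `<=` Jset beta.
Proof.
move=> Jx _ [[n|n] _ <-]; rewrite /iet_iter.
  by elim: n => //= n; exact: Jset_iet.
by elim: n.+1 => //= k; exact: Jset_iet_inv.
Qed.

(** * Joined points share their two-sided orbit *)

Lemma iter_iet_inj n x y : 0 <= x < 1 -> 0 <= y < 1 ->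
  iter n f x = iter n f y -> x = y.
Proof.
move=> x01 y01; elim: n => //= n IH /iet_inj e.
by apply/IH/e; exact: iter_iet_itv01.
Qed.

Lemma iter_iet_invK n x : 0 <= x < 1 ->
  0 <= iter n (iet_inv L S beta) x < 1 /\
  iter n f (iter n (iet_inv L S beta) x) = x.
Proof.
move=> x01; elim: n => //= n [/iet_inv_spec[? e] IH].
by split=> //; rewrite -iterS iterSr e.
Qed.

(** If f ^ p x = f ^ q y, injectivity cancels the smaller number of steps: y is
    then f ^ (p - q) x, or x is f ^ (q - p) y and the inverse leads from x
    to y. *)
Lemma joined_iet_orbit x y : 0 <= x < 1 -> 0 <= y < 1 ->
  joined f x y -> iet_orbit L S beta x y.
Proof.
move=> x01 y01 [p [q]]; have [qp|pq] := leqP q p.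
  rewrite -(subnKC qp) iterD => /iter_iet_inj e.
  by exists (p - q)%N => //=; apply: e => //; exact: iter_iet_itv01.
rewrite -(subnKC (ltnW pq)) iterD => /iter_iet_inj e.
have {}e : x = iter (q - p) f y by apply: e => //; exact: iter_iet_itv01.
(* Negz k stands for - (k + 1), hence the predecessor. *)
exists (Negz (q - p).-1) => //; rewrite /iet_iter prednK ?subn_gt0//.
have [z01 fz] := iter_iet_invK (q - p) x x01.
by apply: (iter_iet_inj (q - p)) => //; rewrite fz.
Qed.

(** * The first return to the first interval is a rotation *)

(** On the long intervals other than the first, f descends by steps of beta; the
    path is read backwards, from its end point u. *)
Lemma joined_long u k : (k < L)%N -> 0 <= u < beta ->
  joined f u (u + k%:R * beta).
Proof.
move=> + ub; elim: k => [|k IH] kL.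
  by rewrite mul0r addr0; exact: joined_refl.
apply: joined_trans (IH (ltnW kL)) _; apply/joined_sym.
have k0 : 0 <= k%:R * beta by rewrite mulr_ge0// ltW.
have kl : k.+2%:R * beta <= L%:R * beta by rewrite ler_wpM2r ?ler_nat// ltW.
move: kl; rewrite -!natr1 !mulrDl !mul1r => kl.
rewrite addrA [in X in joined f _ X](_ : u + _ = f (u + k%:R * beta + beta)).
  exact: joined_step.
by case: ietP => *; iet_lra.
Qed.

(** On the short intervals other than the last, f climbs by steps of
    beta ^ 2. *)
Lemma joined_short x k : (k < S)%N ->
  L%:R * beta <= x < L%:R * beta + beta ^+ 2 ->
  joined f x (x + k%:R * beta ^+ 2).
Proof.
move=> + xb; elim: k => [|k IH] kS.
  by rewrite mul0r addr0; exact: joined_refl.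
apply: joined_trans (IH (ltnW kS)) _.
have k0 : 0 <= k%:R * beta ^+ 2 by rewrite mulr_ge0// ltW.
have kl : k.+2%:R * beta ^+ 2 <= S%:R * beta ^+ 2.
  by rewrite ler_wpM2r ?ler_nat// ltW.
move: kl; rewrite -!natr1 !mulrDl !mul1r => kl.
rewrite addrA (_ : _ + beta ^+ 2 = f (x + k%:R * beta ^+ 2)).
  exact: joined_step.
by case: ietP => *; iet_lra.
Qed.

Lemma joined_last_long u : 0 <= u < beta ->
  joined f (u + (L%:R * beta - beta)) u.
Proof.
move=> ub; apply/joined_sym.
rewrite (_ : L%:R * beta - beta = L.-1%:R * beta).
  by apply: joined_long; rewrite ?prednK.
by rewrite -[in LHS](prednK L_gt0) -natr1; ring.
Qed.

Lemma joined_rotation_low u : 0 <= u < beta - beta ^+ 2 ->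
  joined f u (u + beta ^+ 2).
Proof.
move=> ub; apply: joined_trans (joined_step f u) _.
rewrite (_ : f u = u + beta ^+ 2 + (L%:R * beta - beta)).
  by apply: joined_last_long; iet_lra.
by case: ietP => *; iet_lra.
Qed.

(** The part of the first interval that the rotation wraps around is sent onto
    the bottom short interval [L beta, L beta + beta ^ 2[. *)
Lemma joined_overflow t : 0 <= t < beta ^+ 2 ->
  joined f (t + beta - beta ^+ 2) (t + L%:R * beta).
Proof.
move=> tb; apply: joined_trans (joined_step f _) _.
rewrite (_ : f _ = t + L%:R * beta); first exact: joined_refl.
by case: ietP => *; iet_lra.
Qed.

(** From the bottom short interval, S - 1 steps lead to the last interval, since
    t + L beta + (S - 1) beta ^ 2 = t + 1 - beta ^ 2, whence f jumps to the last
    long interval. *)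
Lemma joined_rotation_high t : 0 <= t < beta ^+ 2 ->
  joined f (t + beta - beta ^+ 2) t.
Proof.
move=> tb; apply: joined_trans (joined_overflow t tb) _.
have /(_ S.-1) := joined_short (t + L%:R * beta).
rewrite prednK// leqnn => /(_ isT) j.
apply: joined_trans (j _) _; first by iet_lra.
apply: joined_trans (joined_step f _) _.
have e : S%:R * beta ^+ 2 = S.-1%:R * beta ^+ 2 + beta ^+ 2.
  by rewrite -[in LHS](prednK S_gt0) -natr1; ring.
rewrite (_ : f _ = t + (L%:R * beta - beta)).
  by apply: joined_last_long; iet_lra.
by case: ietP => *; move: e; iet_lra.
Qed.

(** A point of a long interval descends to the first interval; a point of a
    short interval is reached from the bottom short interval, hence from the
    wrapped part of the first interval. *)
Lemma joined_base x : 0 <= x < 1 -> lattice beta x ->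
  exists u, [/\ 0 <= u < beta, lattice beta u & joined f x u].
Proof.
have lb := @lattice_beta _ beta; have lb2 := @lattice_beta2 _ beta.
move=> x01 lx; have [xL|Lx] := ltP x (L%:R * beta).
  have [|k kL xk] := euclid_nat _ beta x L; first by lra.
  exists (x - k%:R * beta); split=> //.
    by apply: latticeB => //; exact: (latticeMz k).
  apply/joined_sym; rewrite -[X in joined _ _ X](subrK (k%:R * beta)).
  exact: joined_long.
have [|k kS] := euclid_nat _ (beta ^+ 2) (x - L%:R * beta) S; first by iet_lra.
set t := x - _ - _ => tb.
exists (t + beta - beta ^+ 2); split; first by iet_lra.
  by do ?[apply: latticeD|apply: latticeN] => //; exact: (latticeMz _%:Z).
apply/joined_sym; apply: joined_trans (joined_overflow t tb) _.
rewrite (_ : x = t + L%:R * beta + k%:R * beta ^+ 2); last by rewrite /t; ring.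
by apply: joined_short => //; lra.
Qed.

(** * The lattice points of the first interval form one orbit *)

Lemma rotation_next u : 0 <= u < beta ->
  exists2 m : int, 0 <= m%:~R * beta + (u + beta ^+ 2) < beta
                 & joined f u (m%:~R * beta + (u + beta ^+ 2)).
Proof.
move=> ub; have [uh|uh] := ltP u (beta - beta ^+ 2).
  exists 0; rewrite mul0r add0r; first by iet_lra.
  by apply: joined_rotation_low; lra.
exists (-1); rewrite mulN1r; first by iet_lra.
rewrite [X in joined _ X](_ : u = - beta + (u + beta ^+ 2) + beta - beta ^+ 2).
  by apply: joined_rotation_high; iet_lra.
by ring.
Qed.

Lemma rotation_prev v : 0 <= v < beta ->
  exists2 m : int, 0 <= m%:~R * beta + (v - beta ^+ 2) < beta
                 & joined f (m%:~R * beta + (v - beta ^+ 2)) v.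
Proof.
move=> vb; have [vl|vh] := ltP v (beta ^+ 2).
  exists 1; rewrite mul1r; first by iet_lra.
  rewrite [X in joined _ X](_ : _ = v + beta - beta ^+ 2); last by ring.
  by apply: joined_rotation_high; lra.
exists 0; rewrite mul0r add0r; first by iet_lra.
rewrite -[X in joined _ _ X](subrK (beta ^+ 2)).
by apply: joined_rotation_low; iet_lra.
Qed.

Lemma int_multiple_lt1 (m : int) : 0 <= m%:~R * beta < beta -> m = 0.
Proof.
move=> /andP[]; rewrite pmulr_lge0// ler0z gtr_pMl// => m0.
by rewrite ltrz1 => m1; lia.
Qed.

(** Induction on the coefficient n of beta ^ 2, which one turn of the rotation
    changes by one.  The coefficient m is kept universal, since wrapping around
    changes it; for n = 0 only the point 0 remains. *)
Lemma joined_base0 (n m : int) (u := m%:~R * beta + n%:~R * beta ^+ 2) :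
  0 <= u < beta -> joined f 0 u.
Proof.
rewrite {}/u; elim: n m => [|n IH|n IH] m ub.
- move: ub; rewrite mul0r addr0 => /int_multiple_lt1 ->.
  by rewrite mul0r; exact: joined_refl.
- have [k vb j] := rotation_prev _ ub; apply: joined_trans _ j; move: vb.
  rewrite (_ : _ + _ = (k + m)%:~R * beta + n%:~R * beta ^+ 2).
    exact: IH.
  by rewrite -addn1 PoszD !intrD; ring.
- have [k vb /joined_sym j] := rotation_next _ ub.
  apply: joined_trans _ j; move: vb.
  rewrite (_ : _ + _ = (k + m)%:~R * beta + (- n%:Z)%:~R * beta ^+ 2).
    exact: IH.
  by rewrite -addn1 PoszD !intrN !intrD; ring.
Qed.

Lemma Jset_sub_iet_orbit x : Jset beta x -> Jset beta `<=` iet_orbit L S beta x.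
Proof.
have joined0 z : 0 <= z < 1 -> lattice beta z -> joined f 0 z.
  move=> z01 lz; have [u [ub [m [n uE]] /joined_sym]] := joined_base z z01 lz.
  by apply: joined_trans; move: ub; rewrite uE; exact: joined_base0.
move=> /JsetE[x01 lx] y /JsetE[y01 ly]; apply: joined_iet_orbit => //.
by apply: joined_trans (joined0 y y01 ly); apply/joined_sym; exact: joined0.
Qed.

End Exchange.

Theorem theorem3p8 (R : realType) (L S : nat) (beta : R) (r q0 : int) (x0 : R) :
  (1 <= L)%N -> (1 <= S)%N ->
  0 < beta -> L%:R * beta + S%:R * beta ^+ 2 = 1 ->
  fpart (- r%:~R * beta - q0%:~R * beta ^+ 2) \in iet_itv L beta 1 ->
  fpart (- r%:~R * beta - (q0 + 1)%:~R * beta ^+ 2) \notin iet_itv L beta 1 ->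
  x0 = fpart (- r%:~R * beta - q0%:~R * beta ^+ 2) ->
  (S <= L)%N ->
  iet_orbit L S beta x0 = Jset beta.
Proof.
move=> L_gt0 S_gt0 beta_gt0 total _ _ x0E _.
have Jx0 : Jset beta x0 by exists (- r), (- q0); rewrite x0E !intrN !mulNr.
apply/seteqP; split; first exact: iet_orbit_sub_Jset.
exact: Jset_sub_iet_orbit.
Qed.
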